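(* Let $Y=[y_L,y_U]$ be a random interval with $\mathbf E(|y_L|+|y_U|)<\infty$. Suppose either (i) $r$ is a positive odd integer, or (ii) $r>0$ and $y_L\ge0$ almost surely; suppose also that $y_L^r$ and $y_U^r$ are integrable. Let $\mu_r\in[\mathbf E(y_L^r),\mathbf E(y_U^r)]$. For $\lambda\in\mathbb R$ and $\omega\in\Omega$ define $$\Psi_r(\lambda,\omega):=\sup_{x\in Y(\omega)}(x+\lambda x^r),\qquad \Phi_r(\lambda,\omega):=\inf_{x\in Y(\omega)}(x+\lambda x^r).$$ Then $$\overline m(r,\mu_r)=\inf_{\lambda\in\mathbb R}\big\{\mathbf E[\Psi_r(\lambda,\cdot)]-\lambda\mu_r\big\},\qquad \underline m(r,\mu_r)=\sup_{\lambda\in\mathbb R}\big\{\mathbf E[\Phi_r(\lambda,\cdot)]-\lambda\mu_r\big\}.$$ In particular, the $r$th-moment restricted mean set $\{\mathbf E[y]:y\in\mathbf{Sel}_r(Y\mid\mu_r)\}$ is a nonempty compact interval $[\underline m(r,\mu_r),\overline m(r,\mu_r)]\subseteq[\mathbf E y_L,\mathbf E y_U]$.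
   Context: $(\Omega,\mathcal A,\mathbf P)$ is a complete non-atomic probability space. A random interval is $Y(\omega)=[y_L(\omega),y_U(\omega)]\subset\mathbb R$ with $y_L,y_U$ measurable real-valued and $\mathbf P(y_L\le y_U)=1$. $\mathbf{Sel}(Y)$ is the set of measurable $y:\Omega\to\mathbb R$ with $y(\omega)\in Y(\omega)$ a.s. The $r$th-moment restricted selection set is $\mathbf{Sel}_r(Y\mid\mu_r):=\{y\in\mathbf{Sel}(Y):\mathbf E|y|^r<\infty,\ \mathbf E[y^r]=\mu_r\}$. Define $\underline m(r,\mu_r):=\inf_{y\in\mathbf{Sel}_r(Y\mid\mu_r)}\mathbf E[y]$ and $\overline m(r,\mu_r):=\sup_{y\in\mathbf{Sel}_r(Y\mid\mu_r)}\mathbf E[y]$ (with values $+\infty$ and $-\infty$, respectively, if the set is empty). *)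

(* Defs.v *)
From HB Require Import structures.
From mathcomp Require Import all_boot all_order all_algebra.
From mathcomp Require Import all_classical all_reals all_analysis.

Set Implicit Arguments.
Unset Strict Implicit.
Unset Printing Implicit Defensive.

Import Order.TTheory GRing.Theory Num.Theory.
Import numFieldNormedType.Exports.

Local Open Scope classical_set_scope.
Local Open Scope ring_scope.

Definition nonatomic d (T : measurableType d) (R : realType)
    (P : probability T R) :=
  forall A : set T, measurable A -> (0 < P A)%E ->
    exists B : set T,
      [/\ measurable B, B `<=` A, (0 < P B)%E & (P B < P A)%E].

(* [x `^ r] is only meaningful for [0 <= x] ([x `^ r = 1] when [x < 0]), so
   natural exponents go through the ring power, which gives negative bases
   their usual integer powers; on [0 <= x] the two agree.  When [x < 0] and
   [r] is not a natural number the value is a dummy. *)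
Definition rpow (R : realType) (x r : R) : R :=
  if r \is a Num.nat then x ^+ Num.truncn r else x `^ r.

Section selections.
Context d (T : measurableType d) (R : realType) (P : probability T R).

Definition random_interval (yL yU : {RV P >-> R}) :=
  P [set w | yL w <= yU w] = 1%E.

Definition interval_at (yL yU : {RV P >-> R}) (w : T) : set R :=
  `[yL w, yU w]%classic.

Definition Sel (yL yU : {RV P >-> R}) : set {RV P >-> R} :=
  [set y | {ae P, forall w, interval_at yL yU w (y w)}].

Definition Sel_r (yL yU : {RV P >-> R}) (r mu : R) : set {RV P >-> R} :=
  [set y | [/\ Sel yL yU y,
    ('E_P[fun w => rpow `|y w| r] < +oo)%E &
    ('E_P[fun w => rpow (y w) r] = mu%:E)%E]].

Definition restricted_mean_set (yL yU : {RV P >-> R}) (r mu : R) :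
    set (\bar R) :=
  [set ('E_P[y])%E | y in Sel_r yL yU r mu].

Definition m_lower (yL yU : {RV P >-> R}) (r mu : R) : \bar R :=
  ereal_inf (restricted_mean_set yL yU r mu).

Definition m_upper (yL yU : {RV P >-> R}) (r mu : R) : \bar R :=
  ereal_sup (restricted_mean_set yL yU r mu).

(* Extended-real valued: on the null set where [yU w < yL w] the interval is
   empty and [Psi], [Phi] are [-oo], [+oo]. *)
Definition Psi (yL yU : {RV P >-> R}) (r lam : R) (w : T) : \bar R :=
  ereal_sup [set (x + lam * rpow x r)%:E | x in interval_at yL yU w].

Definition Phi (yL yU : {RV P >-> R}) (r lam : R) (w : T) : \bar R :=
  ereal_inf [set (x + lam * rpow x r)%:E | x in interval_at yL yU w].

End selections.

(* Main.v *)
Require Import Defs.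
From HB Require Import structures.
From mathcomp Require Import all_boot all_order all_algebra.
From mathcomp Require Import all_classical all_reals all_analysis.
From mathcomp Require Import measurable_realfun lra ring.

Set Implicit Arguments.
Unset Strict Implicit.
Unset Printing Implicit Defensive.

Import Order.TTheory GRing.Theory Num.Theory.
Import numFieldNormedType.Exports.

Local Open Scope classical_set_scope.
Local Open Scope ring_scope.

(** The map x |-> x^r is an increasing homeomorphism on the values that matter,
so the moment constraint becomes linear after the substitution s = x^r: with
L = y_L^r, U = y_U^r and g the inverse power, the restricted selections
correspond to the measurable S with L <= S <= U and E S = mu, and the objective
becomes E g(S).  In both cases of the theorem the power agrees, almost surely
on the interval, with one homeomorphism of the whole line, the signed power
[spow r]; the duality below uses of g only that it is continuous and monotone.

For a multiplier lam let M_lam be the maximum of g(s) + lam s over [L, U]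
([envelope]) and G(lam) = E M_lam - lam mu ([dual_value]).  Every admissible S
satisfies E g(S) <= G(lam) ([weak_duality]).  For the converse suppose first
that E L < mu <= E U.  Then G is continuous and attains its minimum at some lam
([dual_value_min]).  Pointwise, the right and left derivatives of l |-> M_l at
lam are the largest and the smallest maximizers hi and lo of g(s) + lam s, so
minimality of lam, passed through dominated convergence, says
E lo <= mu <= E hi ([extreme_maximizers]).  As P is atomless, so is the measure
with density hi - lo, and Sierpinski's theorem
([atomless_integral_intermediate_value]) produces an event A such that
S = hi on A, lo elsewhere, has E S = mu.  This S maximizes the Lagrangian
pointwise, hence E g(S) = G(lam) and both sides of the duality are attained.
If mu = E L, the minimum of G may fail to be attained; then S = L, and G(-n)
tends to E g(L) because a large negative multiplier forces the maximizer
towards L.  This is [strong_duality].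

The lower value follows by the reflection s |-> -s, under which g, an odd
function, is unchanged.  Finally, any two admissible S_0, S_1 are joined by the
segment (1-t) S_0 + t S_1 of admissible functions, along which E g is
continuous; the intermediate value theorem fills the interval between the two
extreme means ([selection_intermediate_value]). *)

(** * The signed power, a homeomorphism of the line *)

Section signed_power.
Context {R : realType}.
Implicit Types r x : R.

(** This is sgn(x) |x|^r for r > 0: on each half-line one of the two terms is
[0 `^ r], which vanishes. *)
Definition spow r x : R := Num.max x 0 `^ r - Num.max (- x) 0 `^ r.

Lemma spowN r x : spow r (- x) = - spow r x.
Proof. by rewrite /spow opprK opprB. Qed.

Lemma spow_powR r x : 0 < r -> 0 <= x -> spow r x = x `^ r.
Proof.
move=> r0 x0; rewrite /spow (max_idPl x0).
by rewrite (max_idPr _) ?oppr_le0// powR0 ?subr0 ?gt_eqF.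
Qed.

Lemma spowK r : 0 < r -> cancel (spow r) (spow r^-1).
Proof.
move=> r0; have Kpos x : 0 <= x -> spow r^-1 (spow r x) = x.
  move=> x0; rewrite (spow_powR r0 x0) spow_powR ?invr_gt0 ?powR_ge0//.
  by rewrite -powRrM divff ?gt_eqF// powRr1.
move=> x; have [x0|/ltW x0] := leP 0 x; first exact: Kpos.
by apply: oppr_inj; rewrite -!spowN Kpos// oppr_ge0.
Qed.

Lemma spowVK r : 0 < r -> cancel (spow r^-1) (spow r).
Proof. by move=> r0; rewrite -{2}(invrK r); apply: spowK; rewrite invr_gt0. Qed.

Lemma spow_homo r : 0 < r -> {homo spow r : x y / x <= y}.
Proof.
move=> r0 x y xy; have max0 (z : R) : Num.max z 0 \is Num.nneg.
  by rewrite nnegrE le_max lexx orbT.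
have maxS (z t : R) : z <= t -> Num.max z 0 <= Num.max t 0.
  by move=> zt; rewrite ge_max !le_max zt lexx orbT.
by apply: lerB; apply: ge0_ler_powR; rewrite ?(ltW r0) ?max0 ?maxS ?lerN2.
Qed.

Lemma spow_mono r : 0 < r -> {mono spow r : x y / x <= y}.
Proof.
move=> r0; apply: le_mono => x y xy; rewrite lt_neqAle spow_homo ?ltW// andbT.
by rewrite (can_eq (spowK r0)) lt_eqF.
Qed.

Lemma le_spowVr r x s : 0 < r -> (x <= spow r^-1 s) = (spow r x <= s).
Proof. by move=> r0; rewrite -(spow_mono r0) spowVK. Qed.

Lemma le_spowVl r x s : 0 < r -> (spow r^-1 s <= x) = (s <= spow r x).
Proof. by move=> r0; rewrite -(spow_mono r0) spowVK. Qed.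

(** A strictly increasing map that is onto an interval is continuous there. *)
Lemma continuous_spow r : 0 < r -> continuous (spow r).
Proof.
move=> r0 x; have x1 : x - 1 < x + 1 by lra.
suff /continuous_within_itvP -/(_ x1)[+ _ _] :
    {within `[x - 1, x + 1], continuous (spow r)}.
  by apply; rewrite in_itv/=; apply/andP; split; lra.
apply: segment_inc_surj_continuous; first by move=> ? ? _ _; exact: spow_mono.
move=> y /=; rewrite in_itv/= => yab; exists (spow r^-1 y); last exact: spowVK.
by rewrite /= in_itv/= (le_spowVr (x - 1) y r0) (le_spowVl (x + 1) y r0).
Qed.

(** The next two lemmas cover the two cases of the main theorem: they replace
the case-dependent power [rpow] by the homeomorphism [spow]. *)
Lemma rpow_ge0E r x : 0 < r -> 0 <= x -> rpow x r = spow r x.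
Proof.
move=> r0 x0; rewrite spow_powR// /rpow; case: ifPn => // rnat.
by rewrite -powR_mulrn// truncnK.
Qed.

Lemma rpow_odd n x : odd n -> rpow x n%:R = spow n%:R x.
Proof.
move=> on; have n0 : 0 < n%:R :> R by rewrite ltr0n odd_gt0.
rewrite /rpow rpred_nat natrK.
have [x0|x0] := leP 0 x; first by rewrite spow_powR// powR_mulrn.
rewrite -[x]opprK spowN spow_powR ?oppr_ge0 ?ltW//.
by rewrite powR_mulrn ?oppr_ge0 ?ltW// (exprNn (- x)) -signr_odd on expr1 mulN1r.
Qed.

Lemma rpow_normE r x : 0 < r -> rpow `|x| r = `|spow r x|.
Proof.
move=> r0; rewrite rpow_ge0E//; have [x0|x0] := ger0P x.
  by rewrite ger0_norm// spow_powR ?powR_ge0.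
by rewrite spowN ltr0_norm// -oppr_gt0 -spowN spow_powR ?powR_gt0 ?oppr_gt0// oppr_ge0 ltW.
Qed.

End signed_power.

(** * Maxima of continuous functions over intervals *)

Section maximum.
Context {R : realType}.
Implicit Types (f g : R -> R) (a b s : R).

Definition maxon f a b : R := sup (f @` `[a, b]).

Lemma maxon_attained f a b : a <= b -> continuous f ->
  exists c, [/\ a <= c <= b, f c = maxon f a b &
    forall s, a <= s <= b -> f s <= f c].
Proof.
move=> ab cf; have [|c + fmax] := @EVT_max R f a b ab.
  by move=> x; exact: continuous_subspaceT.
rewrite in_itv/= => cab; have fc s : a <= s <= b -> f s <= f c.
  by move=> sab; apply: fmax; rewrite in_itv.
have fcub : ubound (f @` `[a, b]) (f c).
  by move=> y [s /=]; rewrite in_itv/= => /fc + <-.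
exists c; split=> //; apply/le_anti/andP; split.
  apply: ub_le_sup; first by exists (f c).
  by exists c => //=; rewrite in_itv.
by apply: ge_sup => //; exists (f c), c => //=; rewrite in_itv.
Qed.

Lemma maxon_ub f a b s : continuous f -> a <= s <= b -> f s <= maxon f a b.
Proof.
move=> cf /[dup] sab /andP[sa sb].
by have [c [_ <-]] := maxon_attained (le_trans sa sb) cf; apply.
Qed.

Lemma ereal_sup_maxon f a b : a <= b -> continuous f ->
  ereal_sup [set (f s)%:E | s in `[a, b]] = (maxon f a b)%:E.
Proof.
move=> ab cf; have [c [cab <- fmax]] := maxon_attained ab cf.
apply/le_anti/andP; split.
  by apply: ge_ereal_sup => y [s /= + <-]; rewrite in_itv/= lee_fin => /fmax.
by apply: ereal_sup_ubound; exists c => //=; rewrite in_itv.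
Qed.

Lemma maxon_reflect f a b :
  maxon f a b = maxon (fun s => f (- s)) (- b) (- a).
Proof.
congr sup; apply/seteqP; split=> y [s /=]; rewrite in_itv/= => /andP[sa sb] <-.
  by exists (- s); rewrite ?opprK//= in_itv/= !lerN2 sa sb.
by exists (- s) => //=; rewrite in_itv/= lerNr lerNl sa sb.
Qed.

Definition clamp a b s : R := Num.max a (Num.min s b).

Lemma clamp_itv a b s : a <= b -> a <= clamp a b s <= b.
Proof. by move=> ab; rewrite le_max lexx/= ge_max ab ge_min lexx orbT. Qed.

Lemma clamp_id a b s : a <= s <= b -> clamp a b s = s.
Proof. by move=> /andP[sa sb]; rewrite /clamp (min_idPl sb) (max_idPr sa). Qed.

Lemma clamp_dist a b s c : a <= c <= b -> `|clamp a b s - c| <= `|s - c|.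
Proof.
move=> /andP[ac cb]; rewrite /clamp; have [sb|bs] := leP s b.
  have [sa|sa] := leP a s; first by [].
  by rewrite !ler0_norm; lra.
by have [ba|ba] := leP a b; [rewrite !ger0_norm; lra|exfalso; lra].
Qed.

(** Both [max] and [min] are 1-Lipschitz. *)
Lemma continuous_clamp a b : continuous (clamp a b).
Proof.
have maxP x y : y <= x -> 0 <= Num.max a x - Num.max a y <= x - y.
  by move=> yx; case: (leP a x); case: (leP a y); lra.
have minP x y : y <= x -> 0 <= Num.min x b - Num.min y b <= x - y.
  by move=> yx; case: (leP x b); case: (leP y b); lra.
move=> x; apply/cvgrPdist_le => e e0; exists e => //= y /ltW.
apply: le_trans; wlog yx : x y / y <= x => [lip|].
  by have /orP[/lip//|/lip] := le_total y x; rewrite distrC [leRHS]distrC.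
have /andP[min0 minxy] := minP _ _ yx.
rewrite subr_ge0 in min0; have /andP[max0 maxxy] := maxP _ _ min0.
by rewrite /clamp ger0_norm// ger0_norm ?subr_ge0//; apply: le_trans maxxy minxy.
Qed.

Definition rat_enum n : R := ratr (odflt 0 (unpickle n)).

(** A countable supremum, with points that depend measurably on the interval;
this is what makes the maximum over a random interval measurable.  Clamping the
rationals, rather than selecting those inside the interval, covers degenerate
intervals too. *)
Lemma maxon_rat f a b : a <= b -> continuous f ->
  maxon f a b = sup (range (fun n => f (clamp a b (rat_enum n)))).
Proof.
move=> ab cf; have [c [cab <- fmax]] := maxon_attained ab cf.
set A := (X in _ = sup X); have Aub : ubound A (f c).
  by move=> _ [n _ <-]; apply: fmax; exact: clamp_itv.
have A0 : A !=set0 by exists (f (clamp a b (rat_enum 0))), 0%N.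
apply/le_anti/andP; split; last exact: ge_sup.
apply/ler_addgt0Pr => e e0.
have /cvgrPdist_le/(_ _ e0)[d /= d0 fd] := cf c.
have /rat_in_itvoo[q] : c - d < c + d by lra.
rewrite in_itv/= => /andP[q1 q2].
have := fd (clamp a b (ratr q)); rewrite /ball_/= distrC => /(_ _)/wrap[].
  by apply: (le_lt_trans (clamp_dist _ cab)); rewrite ltr_norml; apply/andP; split; lra.
move=> /(le_trans (ler_norm _)); rewrite lerBlDl => /le_trans; apply.
rewrite lerD2r//; apply: ub_le_sup; first by exists (f c).
by exists (pickle q) => //; rewrite /rat_enum pickleK.
Qed.

Lemma measurable_clamp d (T : measurableType d) (L U S : T -> R) :
  measurable_fun setT L -> measurable_fun setT U -> measurable_fun setT S ->
  measurable_fun setT (fun w => clamp (L w) (U w) (S w)).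
Proof.
move=> mL mU mS; apply: measurable_maxr => //; exact: measurable_minr.
Qed.

Lemma measurable_maxon d (T : measurableType d) f (L U : T -> R) :
  continuous f -> measurable_fun setT L -> measurable_fun setT U ->
  (forall w, L w <= U w) -> measurable_fun setT (fun w => maxon f (L w) (U w)).
Proof.
move=> cf mL mU LU.
pose h n w := f (clamp (L w) (U w) (rat_enum n)).
rewrite (_ : (fun _ => _) = (fun w => sups (h ^~ w) 0)); last first.
  apply/funext => w; rewrite maxon_rat//; congr sup.
  by apply/seteqP; split=> _ [n _ <-]; exists n.
apply: measurable_fun_sups.
  move=> w _; exists (maxon f (L w) (U w)) => _ [n _ <-].
  by apply: maxon_ub => //; exact: clamp_itv.
move=> n; apply: measurableT_comp; first exact: continuous_measurable_fun.
exact: measurable_clamp.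
Qed.

(** Danskin's theorem in one variable: the right derivative at v = 0 of the
maximum of f(s) + v s is the largest maximizer c of f.  It is at least c because
c itself competes; and a maximizer of the perturbed function cannot stay above
c + e for small v, since f is bounded away from its maximum there.
Writing the largest maximizer as a limit of difference quotients also shows that
it depends measurably on the interval. *)
Lemma maxon_right_quotient f a b : a <= b -> continuous f ->
  exists c, [/\ a <= c <= b, f c = maxon f a b,
    forall s, a <= s <= b -> f s = maxon f a b -> s <= c &
    n.+1%:R * (maxon (fun s => f s + n.+1%:R^-1 * s) a b - maxon f a b)
      @[n --> \oo] --> c].
Proof.
move=> ab cf; have [m [mab fm mmax]] := maxon_attained ab cf.
pose A := `[a, b] `&` f @^-1` [set y | maxon f a b <= y].
have cA : compact A.
  apply: compact_closedI; first exact: segment_compact.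
  by apply: preimage_closed => //; exact: closed_ge.
have [|c|c + cmax] := @compact_EVT_max _ R id A _ cA.
- by exists m; split=> /=; rewrite ?in_itv//= fm.
- by apply: continuous_subspaceT => x; exact: cvg_id.
rewrite inE => -[] /=; rewrite in_itv/= => cab fc.
have {}fc : f c = maxon f a b by apply/le_anti; rewrite fc maxon_ub.
have {}cmax s : a <= s <= b -> f s = maxon f a b -> s <= c.
  by move=> sab fs; apply: cmax; rewrite inE; split=> //=; rewrite ?in_itv//= fs.
exists c; split=> //; apply/cvgrPdist_le => e e0.
have [N HN] : exists N, forall n s, (N <= n)%N -> a <= s <= b -> c + e <= s ->
    f s + n.+1%:R^-1 * s < maxon f a b + n.+1%:R^-1 * c.
  have [cb|cb] := leP (c + e) b; last first.
    by exists 0%N => n s _ /andP[_ sb] cs; exfalso; lra.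
  have [m' [/andP[m'1 m'2] _ m'max]] := maxon_attained cb cf.
  have gap : 0 < maxon f a b - f m'.
    have am' : a <= m' by move/andP: cab => [ac _]; lra.
    rewrite subr_gt0 lt_neqAle maxon_ub ?am'// andbT; apply/eqP => fm'.
    have : m' <= c by apply: cmax; rewrite ?am'.
    by lra.
  (* For larger n the perturbation gains at most (b - c) / (n + 1) over c, which
     is less than the gap. *)
  exists (Num.truncn ((b - c) / (maxon f a b - f m'))) => n s Nn /andP[as_ sb] cs.
  have fs : f s <= f m' by apply: m'max; rewrite cs.
  have n0 : 0 < n.+1%:R :> R by rewrite ltr0n.
  have : (b - c) / (maxon f a b - f m') < n.+1%:R.
    by apply: (lt_le_trans (truncnS_gt _)); rewrite ler_nat.
  rewrite ltr_pdivrMr// mulrC -ltr_pdivrMr// mulrC => h.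
  have : n.+1%:R^-1 * (s - c) <= n.+1%:R^-1 * (b - c).
    by rewrite ler_pM2l ?invr_gt0//; lra.
  move: h fs; rewrite !mulrBr.
  by move: (_ * s) (_ * b) (_ * c) => vs vb vc; lra.
exists N => // n /= Nn; have n0 : 0 < n.+1%:R :> R by rewrite ltr0n.
have cfn : continuous (fun s => f s + n.+1%:R^-1 * s).
  by move=> x; apply: cvgD; [exact: cf|exact: mulrl_continuous].
have [s [sab Es smax]] := maxon_attained ab cfn.
have fs : f s <= maxon f a b by exact: maxon_ub.
have sc : s < c + e.
  rewrite ltNge; apply/negP => cs; have := smax c cab; rewrite leNgt.
  by move/negP; apply; rewrite fc; exact: HN.
have lo : c <= n.+1%:R * (maxon (fun s => f s + n.+1%:R^-1 * s) a b - maxon f a b).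
  rewrite mulrC -ler_pdivrMr// mulrC.
  by have := smax c cab; rewrite -Es fc; move: (_ * c) (_ * s) => vc vs; lra.
have hi : n.+1%:R * (maxon (fun s => f s + n.+1%:R^-1 * s) a b - maxon f a b) <= s.
  by rewrite mulrC -ler_pdivlMr// mulrC -Es; move: (_ * s) => vs; lra.
by rewrite distrC ger0_norm ?subr_ge0//; lra.
Qed.

Lemma maxon_left_quotient f a b : a <= b -> continuous f ->
  exists c, [/\ a <= c <= b, f c = maxon f a b &
    n.+1%:R * (maxon f a b - maxon (fun s => f s - n.+1%:R^-1 * s) a b)
      @[n --> \oo] --> c].
Proof.
move=> ab cf; have ba : - b <= - a by rewrite lerN2.
have cfN : continuous (fun s => f (- s)).
  by move=> x; apply: (@continuous_comp R R R -%R f); [exact: oppr_continuous|exact: cf].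
have [c [/andP[c1 c2] fc _ cvgc]] := maxon_right_quotient ba cfN.
rewrite -maxon_reflect in fc; exists (- c); split => //.
- by rewrite lerNr lerNl c1 c2.
- apply: cvg_trans (cvgN cvgc); apply: near_eq_cvg; apply: nearW => n /=.
  rewrite (maxon_reflect f) (maxon_reflect (fun s => f s - _)).
  rewrite fctE -mulrN opprB; congr (_ * (_ - maxon _ _ _)).
  by apply/funext => s; rewrite mulrN opprK.
Qed.

(** A slope -n pins the maximizer to the left endpoint: beyond a distance d the
penalty n d exceeds the total increase of g, and within d continuity bounds the
gain. *)
Lemma maxon_penalized g a b : a <= b -> continuous g ->
  {homo g : x y / x <= y} ->
  maxon (fun s => g s - n%:R * s) a b + n%:R * a @[n --> \oo] --> g a.
Proof.
move=> ab cg ng; apply/cvgrPdist_le => e e0.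
have /cvgrPdist_le/(_ _ e0)[d /= d0 gd] := cg a.
have b_ge : 0 <= (g b - g a) / (d / 2) by rewrite divr_ge0// ?subr_ge0 ?ng//; lra.
exists (Num.truncn ((g b - g a) / (d / 2))).+1 => // n /= Nn.
have cn : continuous (fun s => g s - n%:R * s).
  by move=> x; apply: cvgB; [exact: cg|exact: mulrl_continuous].
have [s [/andP[as_ sb] <- smax]] := maxon_attained ab cn.
have := smax a; rewrite lexx => /(_ ab) lo.
have n0 : 0 <= n%:R * (s - a) by rewrite mulr_ge0// subr_ge0.
have hi : g s - n%:R * (s - a) <= g a + e.
  have [sd|sd] := ltP (s - a) d.
    have := gd s; rewrite /ball_/= distrC ger0_norm ?subr_ge0// => /(_ sd).
    by rewrite distrC => /(le_trans (ler_norm _)); lra.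
  have gsb : g s <= g b by exact: ng.
  have : (g b - g a) / (d / 2) < n%:R.
    by apply: (lt_le_trans (truncnS_gt _)); rewrite ler_nat.
  rewrite ltr_pdivrMr; last lra.
  have : n%:R * (d / 2) <= n%:R * (s - a) by rewrite ler_wpM2l//; lra.
  by lra.
by rewrite distrC ger0_norm; move: n0 hi lo; rewrite mulrBr; lra.
Qed.

End maximum.

(** * Atomless measures take all intermediate values *)

Section sierpinski.
Context d (T : measurableType d) (R : realType).
Variable m : {measure set T -> \bar R}.
Hypothesis m_fin : (m setT < +oo)%E.

(** Same condition as [nonatomic], for measures that need not have total mass 1:
it is applied to the measure with density the gap between two maximizers. *)
Definition atomless := forall A : set T, measurable A -> (0 < m A)%E ->
  exists B : set T, [/\ measurable B, B `<=` A, (0 < m B)%E & (m B < m A)%E].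

Let mu (A : set T) : R := fine (m A).

Let muE A : measurable A -> (mu A)%:E = m A.
Proof.
move=> mA; rewrite /mu fineK// ge0_fin_numE//; apply: le_lt_trans m_fin.
by apply: le_measure; rewrite ?inE.
Qed.

Let mu_ge0 A : 0 <= mu A. Proof. by rewrite fine_ge0. Qed.

Let mu0 : mu set0 = 0. Proof. by rewrite /mu measure0. Qed.

Let muU A B : measurable A -> measurable B -> B `<=` ~` A ->
  mu (A `|` B) = mu A + mu B.
Proof.
move=> mA mB BA; apply: EFin_inj; rewrite EFinD !muE//; last exact: measurableU.
by rewrite measureU//; apply/seteqP; split=> // x [Ax /BA].
Qed.

Let le_mu A B : measurable A -> measurable B -> A `<=` B -> mu A <= mu B.
Proof. by move=> mA mB AB; rewrite -lee_fin !muE// le_measure ?inE. Qed.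

Hypothesis m_atomless : atomless.

(** Cutting a set in two and keeping the lighter piece halves the measure; the
bound by 1 / (n + 1) is a coarser one that is easier to propagate. *)
Lemma atomless_small_subset A (e : R) : measurable A -> (0 < m A)%E -> 0 < e ->
  exists B, [/\ measurable B, B `<=` A, (0 < m B)%E & (m B < e%:E)%E].
Proof.
move=> mA A0 e0; have halve n : exists B,
    [/\ measurable B, B `<=` A, 0 < mu B & mu B * n.+1%:R <= mu A].
  elim: n => [|n [B [mB BA B0 Bn]]].
    by exists A; split=> //; rewrite ?mulr1// -lte_fin muE.
  have [|C [mC CB C0 CltB]] := m_atomless mB; first by rewrite -muE// lte_fin.
  have mBC := measurableD mB mC.
  have : mu B = mu C + mu (B `\` C).
    by rewrite -muU// setDUK.
  rewrite -muE// -muE// lte_fin in CltB; rewrite -muE// lte_fin in C0.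
  have n0 : 0 <= n%:R :> R by [].
  have nB : 0 <= n%:R * mu B by rewrite mulr_ge0.
  rewrite -natr1 in Bn.
  move=> BE; have [CD|DC] := leP (mu C) (mu (B `\` C)).
    exists C; split=> //; first exact: subset_trans BA.
    have : n%:R * mu C <= n%:R * mu B by rewrite ler_wpM2l// ltW.
    by rewrite -!natr1; lra.
  exists (B `\` C); split=> //; [by apply: subset_trans BA => x []|lra|].
  have : n%:R * mu (B `\` C) <= n%:R * mu B by rewrite ler_wpM2l//; lra.
  by rewrite -!natr1; lra.
have [B [mB BA B0 Bn]] := halve (Num.truncn (mu A / e)).
exists B; split=> //; rewrite -muE// lte_fin//.
rewrite -(@ltr_pM2r _ (Num.truncn (mu A / e)).+1%:R) ?ltr0n//.
by apply: (le_lt_trans Bn); rewrite mulrC -ltr_pdivrMr// truncnS_gt.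
Qed.

Variable c : R.
Hypothesis c_ge0 : 0 <= c.

Let room := {A : set T | measurable A /\ mu A <= c}.

(** From A, add a set B that exhausts at least half of what can be added in a
single step without exceeding c. *)
Let greedy_step (A : room) : exists B, [/\ measurable B, B `<=` ~` sval A,
  mu (sval A) + mu B <= c & forall B', measurable B' -> B' `<=` ~` sval A ->
    mu (sval A) + mu B' <= c -> mu B' <= mu B * 2].
Proof.
case: A => A /= [mA Ac].
pose V := [set mu B | B in
  [set B | [/\ measurable B, B `<=` ~` A & mu A + mu B <= c]]].
have V0 : V 0.
  by exists set0 => //=; rewrite mu0 addr0; split.
have Vub : has_ubound V.
  by exists c => _ [B [_ _ ABc] <-]; apply: le_trans ABc; rewrite lerDr.
have Vsup B : measurable B -> B `<=` ~` A -> mu A + mu B <= c -> mu B <= sup V.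
  by move=> mB BA ABc; apply: ub_le_sup => //; exists B.
have [V_le0|V_gt0] := leP (sup V) 0.
  exists set0; rewrite mu0; split=> //; first by rewrite addr0.
  by move=> B mB BA /(Vsup _ mB BA)/le_trans; apply; rewrite mul0r.
have [|_ [B [mB BA ABc] <-] supB] := @sup_adherent _ V (sup V / 2) _ (conj (ex_intro _ _ V0) Vub).
  by lra.
exists B; split=> // B' mB' B'A /(Vsup _ mB' B'A); lra.
Qed.

(** Sierpinski's theorem.  Let A be the union of the greedy construction.  If its
measure were below c, a set B outside A of small positive measure could have
been added at every step, so every step would have added at least half the
measure of B, although the increments tend to 0. *)
Lemma atomless_intermediate_value : (c%:E <= m setT)%E ->
  exists2 A, measurable A & m A = c%:E.
Proof.
move=> cT; have [step stepP] := choice greedy_step.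
have room_step (A : room) :
    measurable (sval A `|` step A) /\ mu (sval A `|` step A) <= c.
  have [mB BA ABc _] := stepP A; have mA := (svalP A).1.
  by rewrite muU//; split=> //; exact: measurableU.
have room0 : measurable (@set0 T) /\ mu set0 <= c.
  by rewrite mu0.
pose F n : room := iter n (fun A => exist _ _ (room_step A)) (exist _ _ room0).
have mF n : measurable (sval (F n)) := (svalP (F n)).1.
have Fc n : mu (sval (F n)) <= c := (svalP (F n)).2.
have FS n : sval (F n.+1) = sval (F n) `|` step (F n) by [].
have muFS n : mu (sval (F n.+1)) = mu (sval (F n)) + mu (step (F n)).
  by have [mB BA _ _] := stepP (F n); rewrite FS muU.
pose A := \bigcup_n sval (F n).
have mA : measurable A by exact: bigcup_measurable.
have cvgF : mu (sval (F n)) @[n --> \oo] --> mu A.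
  have ndF : nondecreasing_seq (fun n => sval (F n)).
    by apply/nondecreasing_seqP => n; apply/subsetPset; rewrite FS; exact: subsetUl.
  apply: fine_cvg; rewrite muE//.
  exact: (@nondecreasing_cvg_mu _ _ _ m (fun n => sval (F n))).
have Ac : mu A <= c.
  by apply: (cvgr_to_le cvgF); apply: nearW.
exists A => //; rewrite -muE//; congr EFin; apply/le_anti; rewrite Ac/= leNgt.
apply/negP => ltAc.
have mCA := measurableC mA.
have [||B [mB BA B0 Bsmall]] := @atomless_small_subset (~` A) (c - mu A) mCA.
- rewrite -muE// lte_fin; have : c <= mu setT by rewrite -lee_fin muE.
  rewrite -(setUv A) muU//; lra.
- by lra.
rewrite -muE// lte_fin in B0; rewrite -muE// lte_fin in Bsmall.
have Bstep n : mu B <= (mu (sval (F n.+1)) - mu (sval (F n))) * 2.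
  rewrite muFS [_ + mu (step _)]addrC addrK; have [_ _ _] := stepP (F n); apply => //.
    by move=> x /BA nAx Fx; apply: nAx; exists n.
  have : mu (sval (F n)) <= mu A by apply: le_mu => // x Fx; exists n.
  by lra.
have : (mu (sval (F n.+1)) - mu (sval (F n))) * 2 @[n --> \oo] --> (mu A - mu A) * 2.
  apply: cvgMl; apply: cvgB => //.
  by rewrite (cvg_shiftS (fun n => mu (sval (F n)))).
rewrite subrr mul0r => /cvgr_to_ge/(_ (nearW _ _))-/(_ (mu B)) h.
have : mu B <= 0 by exact: h.
by rewrite leNgt B0.
Qed.

End sierpinski.

Section density.
Context d (T : measurableType d) (R : realType).
Variables (P : {measure set T -> \bar R}) (D : T -> R).
Hypothesis D_ge0 : forall w, 0 <= D w.
Hypothesis D_int : P.-integrable setT (EFin \o D).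

Definition with_density (A : set T) : \bar R := (\int[P]_(w in A) (D w)%:E)%E.

Let with_density0 : with_density set0 = 0%E.
Proof. exact: integral_set0. Qed.

Let with_density_ge0 A : (0 <= with_density A)%E.
Proof. by apply: integral_ge0 => w _; rewrite lee_fin. Qed.

Let with_density_sigma_additive : semi_sigma_additive with_density.
Proof.
apply: semi_sigma_additive_nng_induced; first exact: measurable_int D_int.
by move=> w; rewrite lee_fin.
Qed.

HB.instance Definition _ := isMeasure.Build _ _ _ with_density
  with_density0 with_density_ge0 with_density_sigma_additive.

Lemma with_density_gt0 A : measurable A -> A `<=` [set w | 0 < D w] ->
  (0 < P A)%E -> (0 < with_density A)%E.
Proof.
move=> mA AD PA; rewrite lt0e with_density_ge0 andbT; apply/eqP => DA0.
have mD : measurable_fun A (EFin \o D).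
  by apply: measurable_funS (measurable_int _ D_int).
have /ae_eq_integral_abs : (\int[P]_(w in A) `|(D w)%:E| = 0)%E.
  rewrite -[RHS]DA0; apply: eq_integral => w _.
  by rewrite gee0_abs// lee_fin.
move=> /(_ mA mD); case=> N [mN N0 DN].
have : (P A <= P N)%E.
  apply: le_measure; rewrite ?inE// => w Aw; apply: DN => /= /(_ Aw) [] Dw0.
  by have := AD _ Aw; rewrite /= Dw0 ltxx.
by rewrite N0 leNgt PA.
Qed.

(** A set of positive density measure meets [D > 0] in a set of positive P
measure; P splits the latter, and both pieces keep positive density measure. *)
Lemma atomless_with_density : atomless P -> atomless with_density.
Proof.
move=> P_atomless A mA DA_gt0; have mD := measurable_int _ D_int.
pose A' := A `&` [set w | 0 < D w].
have mA' : measurable A'.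
  apply: measurableI => //.
  rewrite (_ : [set w | 0 < D w] = setT `&` (EFin \o D) @^-1` `]0%E, +oo[).
    exact: mD (emeasurable_itv _).
  by apply/seteqP; split=> w /=; rewrite in_itv/= lte_fin andbT => // -[].
have mDA : measurable_fun A (EFin \o D) by exact: measurable_funS mD.
have PA' : (0 < P A')%E.
  rewrite lt0e measure_ge0 andbT; apply/eqP => PA'0.
  suff DA0 : with_density A = 0%E.
    by have : (0 < with_density A)%E by []; rewrite DA0 ltxx.
  rewrite /with_density (ge0_negligible_integral mA' mA)//; last first.
    by move=> w _; rewrite lee_fin.
  apply: integral0_eq => w [Aw nA'w]; congr EFin; apply/le_anti; rewrite D_ge0 andbT leNgt.
  by apply/negP => Dw; apply: nA'w.
have [B [mB BA' PB ltPB]] := P_atomless A' mA' PA'.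
have BA : B `<=` A by move=> w /BA'[].
have mA'B := measurableD mA' mB.
have fin_dens C : measurable C -> with_density C \is a fin_num.
  by move=> mC; apply: integrable_fin_num => //; exact: integrableS D_int.
exists B; split=> //; first by apply: with_density_gt0 => // w /BA'[].
have A'B_gt0 : (0 < with_density (A' `\` B))%E.
  apply: with_density_gt0 => //; first by move=> w [[]].
  rewrite lt0e measure_ge0 andbT; apply/eqP => PA'B.
  move: ltPB; rewrite -(setDUK BA') measureU//; last by rewrite setDIK.
  by rewrite [X in (_ < _ + X)%E]PA'B adde0 ltxx.
apply: (@lt_le_trans _ _ (with_density A')).
  rewrite -(setDUK BA') measureU//; last by rewrite setDIK.
  by rewrite lteDl ?A'B_gt0//; exact: fin_dens.
by apply: le_measure; rewrite ?inE//; exact: subIsetl.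
Qed.

Lemma atomless_integral_intermediate_value (c : R) : atomless P ->
  0 <= c -> (c%:E <= \int[P]_w (D w)%:E)%E ->
  exists2 A, measurable A & (\int[P]_(w in A) (D w)%:E = c%:E)%E.
Proof.
move=> P_atomless c_ge0 cT.
apply: (@atomless_intermediate_value _ _ _ with_density) => //.
- by have /integrable_fin_num := D_int; rewrite ge0_fin_numE ?with_density_ge0//; apply.
- exact: atomless_with_density.
Qed.

End density.

(** * Integrals of real-valued functions *)

Section real_integral.
Context d (T : measurableType d) (R : realType) (P : probability T R).

Local Notation Rintegrable f := (P.-integrable setT (EFin \o (f : T -> R))).

Lemma Rintegrable_between (f a b : T -> R) : measurable_fun setT f ->
  (forall w, a w <= f w <= b w) -> Rintegrable a -> Rintegrable b ->
  Rintegrable f.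
Proof.
move=> mf abf ia ib.
apply: (@le_integrable _ _ _ P setT _ _ (fun w => `|a w|%:E + `|b w|%:E)%E) => //.
- exact/measurable_EFinP.
- move=> w _ /=; rewrite lee_fin [leRHS]ger0_norm ?addr_ge0//.
  have /andP[af fb] := abf w.
  by case: (ger0P (a w)); case: (ger0P (b w)); case: (ger0P (f w)); lra.
- by apply: integrableD => //; exact: integrable_norm.
Qed.

Lemma RintegrableD (f h : T -> R) : Rintegrable f -> Rintegrable h ->
  Rintegrable (fun w => f w + h w).
Proof. by move=> fi hi; exact: (integrableD measurableT fi hi). Qed.

Lemma RintegrableB (f h : T -> R) : Rintegrable f -> Rintegrable h ->
  Rintegrable (fun w => f w - h w).
Proof. by move=> fi hi; exact: (integrableB measurableT fi hi). Qed.

Lemma RintegrableZ k (f : T -> R) : Rintegrable f -> Rintegrable (fun w => k * f w).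
Proof. by move=> fi; exact: (integrableZl measurableT k fi). Qed.

Lemma Rintegral_cvg (h : nat -> T -> R) (f k : T -> R) :
  (forall n, measurable_fun setT (h n)) ->
  (forall w, h n w @[n --> \oo] --> f w) ->
  Rintegrable k -> (forall n w, `|h n w| <= k w) ->
  \int[P]_w h n w @[n --> \oo] --> \int[P]_w f w.
Proof.
move=> mh hf ik hk.
have mf : measurable_fun setT f by apply: measurable_fun_cvg mh _ => w _; exact: hf.
have [||||  |fi _ cvgi] := @dominated_convergence _ _ _ P setT measurableT
  (fun n => EFin \o h n) (EFin \o f) (EFin \o k).
- by move=> n; exact/measurable_EFinP.
- exact/measurable_EFinP.
- by apply: aeW => w _; apply: cvg_EFin; [exact: nearW|exact: hf].
- exact: ik.
- by apply: aeW => w n _; rewrite lee_fin.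
by apply: fine_cvg; rewrite fineK ?integrable_fin_num.
Qed.

End real_integral.

(** * Lagrangian duality for a linear moment constraint *)

Section lagrangian_duality.
Context d (T : measurableType d) (R : realType) (P : probability T R).
Variables (g : R -> R) (L U : T -> R).

Local Notation Rintegrable f := (P.-integrable setT (EFin \o (f : T -> R))).

Definition lagrangian (l s : R) : R := g s + l * s.

Definition envelope (l : R) (w : T) : R := maxon (lagrangian l) (L w) (U w).

Definition dual_value (mu l : R) : R := \int[P]_w envelope l w - l * mu.

Definition selection (mu : R) (S : T -> R) : Prop :=
  [/\ measurable_fun setT S, forall w, L w <= S w <= U w & \int[P]_w S w = mu].

Hypothesis cg : continuous g.
Hypothesis ng : {homo g : x y / x <= y}.
Hypothesis mL : measurable_fun setT L.
Hypothesis mU : measurable_fun setT U.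
Hypothesis LU : forall w, L w <= U w.
Hypothesis iL : Rintegrable L.
Hypothesis iU : Rintegrable U.
Hypothesis igL : Rintegrable (g \o L).
Hypothesis igU : Rintegrable (g \o U).

Lemma continuous_lagrangian l : continuous (lagrangian l).
Proof. by move=> x; apply: cvgD; [exact: cg|exact: mulrl_continuous]. Qed.
#[local] Hint Resolve continuous_lagrangian : core.

Lemma measurable_continuous_comp (S : T -> R) :
  measurable_fun setT S -> measurable_fun setT (g \o S).
Proof. by move=> mS; apply: measurableT_comp => //; exact: continuous_measurable_fun. Qed.

Lemma integrable_selection (S : T -> R) : measurable_fun setT S ->
  (forall w, L w <= S w <= U w) -> Rintegrable S /\ Rintegrable (g \o S).
Proof.
move=> mS LSU; split; first exact: (Rintegrable_between mS LSU).
apply: (Rintegrable_between (measurable_continuous_comp mS) _ igL igU) => w /=.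
by have /andP[? ?] := LSU w; rewrite !ng.
Qed.

Lemma envelope_ge l w s : L w <= s <= U w -> g s + l * s <= envelope l w.
Proof. by move=> sLU; apply: (@maxon_ub _ (lagrangian l)). Qed.

Lemma envelope_attained l w :
  exists2 s, L w <= s <= U w & envelope l w = g s + l * s.
Proof.
by have [s [sLU sE _]] := maxon_attained (LU w) (@continuous_lagrangian l); exists s.
Qed.

Lemma selection_norm w s : L w <= s <= U w -> `|s| <= `|L w| + `|U w|.
Proof.
move=> /andP[Ls sU].
by case: (ger0P s); case: (ger0P (L w)); case: (ger0P (U w)); lra.
Qed.

Lemma envelope_lipschitz l l' w :
  `|envelope l' w - envelope l w| <= `|l' - l| * (`|L w| + `|U w|).
Proof.
wlog suff: l l' / envelope l' w - envelope l w <= `|l' - l| * (`|L w| + `|U w|).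
  by move=> h; rewrite ler_norml h lerNl opprB distrC h.
have [s sLU ->] := envelope_attained l' w; have := envelope_ge l sLU.
have : (l' - l) * s <= `|l' - l| * (`|L w| + `|U w|).
  apply: (le_trans (ler_norm _)); rewrite normrM ler_wpM2l//.
  exact: selection_norm.
by move: (_ * (_ + _)) => x; lra.
Qed.

Lemma measurable_envelope l : measurable_fun setT (envelope l).
Proof. exact: measurable_maxon. Qed.

Lemma integrable_bound : Rintegrable (fun w => `|L w| + `|U w|).
Proof. by apply: RintegrableD; exact: integrable_norm. Qed.

(** Since g is nondecreasing, the maximum with multiplier 0 is at the right
endpoint. *)
Lemma envelope0 w : envelope 0 w = g (U w).
Proof.
have [s /andP[_ sU] e] := envelope_attained 0 w; apply/le_anti/andP; split.
  by rewrite e mul0r addr0 ng.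
by have := @envelope_ge 0 w (U w); rewrite mul0r addr0 lexx LU; apply.
Qed.

Lemma integrable_envelope l : Rintegrable (envelope l).
Proof.
apply: (@Rintegrable_between _ _ _ _ _
  (fun w => g (U w) - `|l| * (`|L w| + `|U w|))
  (fun w => g (U w) + `|l| * (`|L w| + `|U w|))); first exact: measurable_envelope.
- move=> w; have := envelope_lipschitz 0 l w.
  by rewrite envelope0 subr0 ler_norml => /andP[]; move: (_ * _) => x; lra.
- apply: RintegrableB => //; apply: RintegrableZ; exact: integrable_bound.
- apply: RintegrableD => //; apply: RintegrableZ; exact: integrable_bound.
Qed.

Lemma integral_lagrangian l (S : T -> R) : measurable_fun setT S ->
  (forall w, L w <= S w <= U w) ->
  \int[P]_w (g (S w) + l * S w) = \int[P]_w g (S w) + l * \int[P]_w S w.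
Proof.
move=> mS LSU; have [iS igS] := integrable_selection mS LSU.
by rewrite RintegralD// ?RintegralZl//; exact: RintegrableZ.
Qed.

(** The Lagrangian at a selection is below its pointwise maximum, and the
constraint turns its multiplier term into the constant [l * mu]. *)
Lemma weak_duality mu l S : selection mu S ->
  \int[P]_w g (S w) <= dual_value mu l.
Proof.
move=> [mS LSU <-]; rewrite lerBrDr -integral_lagrangian//.
have [iS igS] := integrable_selection mS LSU.
apply: le_Rintegral => //; last by move=> w _; exact: envelope_ge.
- by apply: RintegrableD => //; exact: RintegrableZ.
- exact: integrable_envelope.
Qed.

Lemma dual_value_lipschitz mu l l' : dual_value mu l' <=
  dual_value mu l + `|l' - l| * (\int[P]_w (`|L w| + `|U w|) + `|mu|).
Proof.
have iE := integrable_envelope; have ib := integrable_bound.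
have : \int[P]_w envelope l' w <=
    \int[P]_w (envelope l w + `|l' - l| * (`|L w| + `|U w|)).
  apply: le_Rintegral => //; first by apply: RintegrableD => //; exact: RintegrableZ.
  move=> w _; have := envelope_lipschitz l l' w.
  by move/(le_trans (ler_norm _)); move: (_ * _) => x; lra.
rewrite RintegralD// ?RintegralZl//; last exact: RintegrableZ.
have : - ((l' - l) * mu) <= `|l' - l| * `|mu|.
  by rewrite -normrM -normrN; exact: ler_norm.
rewrite /dual_value mulrDr mulrBl; move: (`|_| * _) (`|_| * _) => x y; lra.
Qed.

Lemma continuous_dual_value mu : continuous (dual_value mu).
Proof.
move=> l; apply/cvgrPdist_le => e e0.
pose K := \int[P]_w (`|L w| + `|U w|) + `|mu| + 1.
have K0 : 0 < K.
  by rewrite ltr_wpDl// addr_ge0// Rintegral_ge0// => w _; rewrite addr_ge0.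
near=> l'; have : `|l - l'| <= e / K.
  by near: l'; apply: cvgr_dist_le; [exact: cvg_id|rewrite divr_gt0].
rewrite ler_pdivlMr// => h; apply: le_trans h.
have := dual_value_lipschitz mu l l'; have := dual_value_lipschitz mu l' l.
rewrite [`|l' - l|]distrC ler_norml /K.
have := normr_ge0 (l - l').
rewrite [_ * (_ + 1)]mulrDr mulr1; move: (`|_| * _) => x; lra.
Unshelve. all: by end_near. Qed.

(** Using L as a competitor shows that the dual value grows without bound as
l tends to -oo, which needs E L < mu; for l >= 0 the competitor U shows that it
is at least its value at 0.  So the minimum over some [[-K, 0]] is global. *)
Lemma dual_value_min mu : \int[P]_w L w < mu -> mu <= \int[P]_w U w ->
  exists l, forall l', dual_value mu l <= dual_value mu l'.
Proof.
move=> Lmu muU.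
pose K := Num.max 0 ((dual_value mu 0 - \int[P]_w g (L w)) / (mu - \int[P]_w L w)).
have K0 : 0 <= K by rewrite le_max lexx.
have [||l lK lmin] := @EVT_min R (dual_value mu) (- K) 0.
- by rewrite oppr_le0.
- by apply: continuous_subspaceT; exact: continuous_dual_value.
have dual_ge l' S : measurable_fun setT S -> (forall w, L w <= S w <= U w) ->
    \int[P]_w g (S w) + l' * (\int[P]_w S w - mu) <= dual_value mu l'.
  move=> mS LSU; have := @weak_duality (\int[P]_w S w) l' S (And3 mS LSU erefl).
  by rewrite /dual_value mulrBr; lra.
have l0 : dual_value mu l <= dual_value mu 0.
  by apply: lmin; rewrite in_itv/= oppr_le0 K0 lexx.
exists l => l'; have [l'0|l'0] := leP l' 0; last first.
  apply: (le_trans l0); have := dual_ge l' U mU (fun w => _) => /(_ _)/wrap[].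
    by move=> w; rewrite LU lexx.
  apply: le_trans; rewrite /dual_value mul0r subr0.
  under eq_Rintegral do rewrite envelope0.
  by rewrite lerDl mulr_ge0 ?subr_ge0// ltW.
have [Kl'|l'K] := leP (- K) l'; first by apply: lmin; rewrite in_itv/= Kl'.
apply: (le_trans l0); have := dual_ge l' L mL => /(_ _)/wrap[].
  by move=> w; rewrite LU lexx.
apply: le_trans; rewrite -lerBlDl -ler_ndivlMr ?subr_lt0//.
rewrite -lerN2 -mulrN -invrN opprB; apply: le_trans (ltW _); last first.
  by rewrite ltrNr; exact: l'K.
by rewrite /K le_max lexx orbT.
Qed.

Lemma envelope_shift l v w : envelope (l + v) w =
  maxon (fun s => lagrangian l s + v * s) (L w) (U w).
Proof.
by congr maxon; apply/funext => s; rewrite /lagrangian mulrDl addrA.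
Qed.

(** The first-order condition at a minimum of the dual.  Its difference quotients
have a sign, and they are integrals of the difference quotients of the envelope,
which converge to the extreme maximizers and are dominated by |L| + |U|. *)
Lemma extreme_maximizers mu l :
  (forall l', dual_value mu l <= dual_value mu l') ->
  exists lo hi : T -> R, [/\ measurable_fun setT lo /\ measurable_fun setT hi,
    forall w, L w <= lo w /\ lo w <= hi w /\ hi w <= U w,
    forall w, lagrangian l (lo w) = envelope l w /\
              lagrangian l (hi w) = envelope l w,
    \int[P]_w lo w <= mu & mu <= \int[P]_w hi w].
Proof.
move=> lmin.
have [hi hiP] := choice (fun w => maxon_right_quotient (LU w) (@continuous_lagrangian l)).
have [lo loP] := choice (fun w => maxon_left_quotient (LU w) (@continuous_lagrangian l)).
have iE := integrable_envelope; have mE := measurable_envelope.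
pose v n : R := n.+1%:R^-1.
have v0 n : 0 < v n by rewrite invr_gt0.
have vV n : n.+1%:R * v n = 1 by rewrite divff.
pose qhi n w := n.+1%:R * (envelope (l + v n) w - envelope l w).
pose qlo n w := n.+1%:R * (envelope l w - envelope (l - v n) w).
have q_bound n l1 l2 w : `|l1 - l2| = v n ->
    `|n.+1%:R * (envelope l1 w - envelope l2 w)| <= `|L w| + `|U w|.
  move=> l12; rewrite normrM ger0_norm//.
  apply: (le_trans (ler_wpM2l _ (envelope_lipschitz _ _ _))) => //.
  by rewrite l12 mulrA vV mul1r.
have mq n l1 l2 :
    measurable_fun setT (fun w => n.+1%:R * (envelope l1 w - envelope l2 w)).
  by apply: measurable_funM => //; apply: measurable_funB.
have Eq n l1 l2 : \int[P]_w (n.+1%:R * (envelope l1 w - envelope l2 w)) =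
    n.+1%:R * (dual_value mu l1 - dual_value mu l2) + n.+1%:R * (l1 - l2) * mu.
  rewrite RintegralZl ?RintegralB//; last exact: RintegrableB.
  by rewrite /dual_value; ring.
have hi_cvg w : qhi n w @[n --> \oo] --> hi w.
  have [_ _ _] := hiP w; apply: cvg_trans; apply: near_eq_cvg; apply: nearW => n.
  by rewrite /qhi envelope_shift.
have lo_cvg w : qlo n w @[n --> \oo] --> lo w.
  have [_ _] := loP w; apply: cvg_trans; apply: near_eq_cvg; apply: nearW => n.
  rewrite /qlo envelope_shift; congr (_ * (_ - maxon _ _ _)).
  by apply/funext => s; rewrite mulNr.
exists lo, hi; split.
- split.
  + by apply: measurable_fun_cvg (fun n => mq n _ _) (fun w _ => lo_cvg w).
  + by apply: measurable_fun_cvg (fun n => mq n _ _) (fun w _ => hi_cvg w).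
- move=> w; have [/andP[? ?] ? himax _] := hiP w; have [/andP[? ?] ? _] := loP w.
  by do 2!split=> //; apply: himax => //; apply/andP.
- by move=> w; have [_ ? _ _] := hiP w; have [_ ? _] := loP w.
- have lo_bound n : `|l - (l - v n)| = v n by rewrite opprB addrC subrK gtr0_norm.
  have lo_int := Rintegral_cvg (fun n => mq n _ _) lo_cvg integrable_bound
    (fun n w => q_bound n _ _ w (lo_bound n)).
  apply: (cvgr_to_le lo_int).
  apply: nearW => n; rewrite Eq (_ : l - (l - v n) = v n) ?vV ?mul1r ?gerDr; last first.
    by rewrite opprB addrC subrK.
  by rewrite pmulr_rle0// subr_le0.
- have hi_bound n : `|l + v n - l| = v n by rewrite [l + _]addrC addrK gtr0_norm.
  have hi_int := Rintegral_cvg (fun n => mq n _ _) hi_cvg integrable_bound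
    (fun n w => q_bound n _ _ w (hi_bound n)).
  apply: (cvgr_to_ge hi_int).
  apply: nearW => n; rewrite Eq [l + v n]addrC addrK vV mul1r lerDr.
  by rewrite pmulr_rge0// subr_ge0.
Qed.

(** The constraint is affine, so the segment between two selections consists of
selections, and the mean of g varies continuously along it. *)
Lemma selection_intermediate_value mu (S0 S1 : T -> R) (c : R) :
  selection mu S0 -> selection mu S1 ->
  \int[P]_w g (S0 w) <= c <= \int[P]_w g (S1 w) ->
  exists2 S, selection mu S & \int[P]_w g (S w) = c.
Proof.
move=> [mS0 LSU0 ES0] [mS1 LSU1 ES1] c01.
(* Clamping t extends the segment to all real t without leaving the admissible
   functions. *)
pose S t w := S0 w + clamp 0 1 t * (S1 w - S0 w).
have selS t : selection mu (S t).
  have /andP[t0 t1] := clamp_itv t (@ler01 R).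
  have [iS0 _] := integrable_selection mS0 LSU0.
  have [iS1 _] := integrable_selection mS1 LSU1.
  split.
  - apply: measurable_funD => //; apply: measurable_funM => //.
    exact: measurable_funB.
  - move=> w; have /andP[? ?] := LSU0 w; have /andP[? ?] := LSU1 w.
    by rewrite /S; apply/andP; split; nra.
  - rewrite RintegralD// ?RintegralZl// ?RintegralB// ?ES0 ?ES1 ?subrr ?mulr0 ?addr0//;
      do ?apply: RintegrableZ; exact: RintegrableB.
have cphi : {in `]-1, 2[%R, continuous (fun t => \int[P]_w g (S t w))}.
  have := @continuity_under_integral R _ T P (fun t w => g (S t w)) setT
    measurableT (-1) 2 _ _ (fun w => `|g (L w)| + `|g (U w)|) _ _.
  move=> /(_ _ _ _ _)/wrap[||||].
  - by move=> t _; have [mS LSU _] := selS t; have [] := integrable_selection mS LSU.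
  - apply: aeW => w _ t _; apply: (@continuous_comp R R R (S ^~ w) g); last exact: cg.
    apply: cvgD; first exact: cvg_cst.
    by apply: cvgMl; exact: continuous_clamp.
  - by apply: RintegrableD; exact: integrable_norm.
  - move=> t _; apply: aeW => w _; have [_ /(_ w)/andP[? ?] _] := selS t.
    have gL : g (L w) <= g (S t w) by exact: ng.
    have gU : g (S t w) <= g (U w) by exact: ng.
    by case: (ger0P (g (L w))); case: (ger0P (g (U w))); case: (ger0P (g (S t w))); lra.
  by move=> h t tI; apply: h; rewrite inE.
have S0E : S 0 = S0.
  by apply/funext => w; rewrite /S clamp_id ?lexx ?ler01// mul0r addr0.
have S1E : S 1 = S1.
  by apply/funext => w; rewrite /S clamp_id ?lexx ?ler01// mul1r addrC subrK.
have [||t _ <-] := @IVT R (fun t => \int[P]_w g (S t w)) 0 1 c ler01.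
- apply: continuous_in_subspaceT => t; rewrite inE/= in_itv/= => /andP[t0 t1].
  by apply: cphi; rewrite in_itv/=; apply/andP; split; lra.
- rewrite S0E S1E; move/andP: c01 => [c0 c1].
  by rewrite ge_min c0 le_max c1 orbT.
by exists (S t).
Qed.

(** No gap, and the primal optimum is attained: at a minimizer of the dual, mixing
the two extreme maximizers over a suitable event meets the constraint while
staying pointwise optimal. *)
Lemma strong_duality mu : nonatomic P ->
  \int[P]_w L w <= mu <= \int[P]_w U w ->
  exists2 S, selection mu S &
    forall e, 0 < e -> exists l, dual_value mu l <= \int[P]_w g (S w) + e.
Proof.
move=> P_atomless /andP[]; rewrite le_eqVlt => /predU1P[<- _|Lmu muU].
  (* Here L is the only candidate, and the multipliers -n approach its value. *)
  exists L; first by split=> // w; rewrite lexx LU.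
  move=> e e0; pose h n w := envelope (- n%:R) w + n%:R * L w.
  have hE n w : h n w = maxon (fun s => g s - n%:R * s) (L w) (U w) + n%:R * L w.
    by congr (maxon _ _ _ + _); apply/funext => s; rewrite /lagrangian mulNr.
  have h_cvg : \int[P]_w h n w @[n --> \oo] --> \int[P]_w g (L w).
    apply: (@Rintegral_cvg _ _ _ _ _ _ (fun w => `|g (L w)| + `|g (U w)|)).
    - move=> n; apply: measurable_funD; first exact: measurable_envelope.
      exact: measurable_funM.
    - move=> w; apply: cvg_trans (maxon_penalized (LU w) cg ng).
      by apply: near_eq_cvg; apply: nearW => n; rewrite hE.
    - by apply: RintegrableD; exact: integrable_norm.
    - move=> n w; rewrite /h.
      have lo : g (L w) - n%:R * L w <= envelope (- n%:R) w.
        by rewrite -mulNr envelope_ge// lexx LU.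
      have hi : envelope (- n%:R) w <= g (U w) - n%:R * L w.
        have [s /andP[Ls sU] ->] := envelope_attained (- n%:R) w.
        by rewrite mulNr lerB ?ng// ler_wpM2l.
      move: lo hi; move: (_ * _) => x.
      by case: (ger0P (g (L w))); case: (ger0P (g (U w)));
        case: (ger0P (envelope _ w + x)); lra.
  have /cvgrPdist_le/(_ _ e0)[n _ /(_ n)/= /(_ (leqnn n)) hn] := h_cvg.
  exists (- n%:R); rewrite /dual_value mulNr opprK.
  have := integrable_envelope (- n%:R) => iE.
  rewrite /h RintegralD ?RintegralZl// in hn; last exact: RintegrableZ.
  by move: hn; rewrite distrC => /(le_trans (ler_norm _)); lra.
have [l lmin] := dual_value_min Lmu muU.
have [lo [hi [[mlo mhi] lohi argmax lo_mu mu_hi]]] := extreme_maximizers lmin.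
have lo_itv w : L w <= lo w <= U w by have [? [? ?]] := lohi w; apply/andP; split; lra.
have hi_itv w : L w <= hi w <= U w by have [? [? ?]] := lohi w; apply/andP; split; lra.
have [ilo iglo] := integrable_selection mlo lo_itv.
have [ihi ighi] := integrable_selection mhi hi_itv.
pose D w := hi w - lo w; have iD : Rintegrable D by exact: RintegrableB.
have D_ge0 w : 0 <= D w by rewrite subr_ge0; have [_ []] := lohi w.
have [||A mA DA] := @atomless_integral_intermediate_value _ _ _ P D D_ge0 iD
    (mu - \int[P]_w lo w) P_atomless.
- by rewrite subr_ge0.
- have ED : (\int[P]_w (D w)%:E)%E \is a fin_num by exact: integrable_fin_num.
  rewrite -(fineK ED) lee_fin -[fine _]/(\int[P]_w D w) RintegralB//.
  by rewrite lerB.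
pose S w := lo w + (D \_ A) w.
have SE w : S w = lo w \/ S w = hi w.
  rewrite /S /patch; case: ifP => _; last by left; rewrite addr0.
  by right; rewrite /D addrC subrK.
have mDA : measurable_fun setT (D \_ A).
  apply/(measurable_restrict _ mA measurableT); rewrite setTI.
  by apply: measurable_funTS; exact: measurable_funB.
have mS : measurable_fun setT S by exact: measurable_funD.
have S_itv w : L w <= S w <= U w by case: (SE w) => ->.
have ES : \int[P]_w S w = mu.
  have iDA : Rintegrable (D \_ A).
    apply: (Rintegrable_between mDA _ (RintegrableZ 0 iD) iD) => w.
    by rewrite mul0r /patch; case: ifP => _; rewrite ?lexx D_ge0.
  by rewrite RintegralD// -Rintegral_mkcond /Rintegral DA/= addrC subrK.
exists S; first by split.
move=> e e0; exists l; rewrite /dual_value -{1}ES.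
have [iS igS] := integrable_selection mS S_itv.
have EE : \int[P]_w envelope l w = \int[P]_w (g (S w) + l * S w).
  apply: eq_Rintegral => w _; have [elo ehi] := argmax w.
  by case: (SE w) => ->; [rewrite -elo|rewrite -ehi].
by rewrite EE integral_lagrangian// addrK lerDl ltW.
Qed.

End lagrangian_duality.

(** * Transfer between almost sure and pointwise statements *)

Section mean_sets.
Context d (T : measurableType d) (R : realType) (P : probability T R).

(** Completeness supplies the measurability of h, so that it applies to [Psi],
[Phi] and powers of selections, which are controlled only almost surely. *)
Lemma complete_ae_eq_integral (f h : T -> \bar R) : measure_is_complete P ->
  measurable_fun setT f -> {ae P, forall w, f w = h w} ->
  (\int[P]_w h w = \int[P]_w f w)%E.
Proof.
move=> cP mf fh; have {}fh : ae_eq P setT f h by apply: filterS fh => w + _.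
apply/esym/ae_eq_integral => //; exact: ae_measurable_fun fh mf.
Qed.

Lemma ae_eq_integrable (f h : T -> R) : measurable_fun setT f ->
  P.-integrable setT (EFin \o h) -> {ae P, forall w, f w = h w} ->
  P.-integrable setT (EFin \o f).
Proof.
move=> mf /integrableP[mh hoo] fh; apply/integrableP; split.
  exact/measurable_EFinP.
apply: le_lt_trans hoo; rewrite le_eqVlt; apply/orP; left; apply/eqP.
apply: ae_eq_integral => //.
- by apply: measurableT_comp => //; exact/measurable_EFinP.
- exact: measurableT_comp.
- by apply: filterS fh => w /= -> _.
Qed.

Lemma random_interval_ae (yL yU : {RV P >-> R}) : random_interval yL yU ->
  {ae P, forall w, yL w <= yU w}.
Proof.
move=> hY; have mLU : measurable [set w | yL w <= yU w].
  rewrite -[X in measurable X]setTI.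
  by apply: measurable_fun_le => //; exact: measurable_funPT.
exists (~` [set w | yL w <= yU w]); split => //; first exact: measurableC.
by rewrite probability_setC// hY subee.
Qed.

Lemma EFin_Rintegral (f : T -> R) : P.-integrable setT (EFin \o f) ->
  (\int[P]_w (f w)%:E)%E = (\int[P]_w f w)%:E.
Proof. by move=> fi; rewrite fineK//; exact: integrable_fin_num. Qed.

Lemma ereal_inf_approx (I : Type) (F : I -> R) (b : R) :
  (forall i, b <= F i) -> (forall e, 0 < e -> exists i, F i <= b + e) ->
  ereal_inf [set (F i)%:E | i in [set: I]] = b%:E.
Proof.
move=> bF Fb; apply/le_anti/andP; split; last first.
  by apply/ereal_infP => _ [i _ <-]; rewrite lee_fin.
apply/lee_addgt0Pr => e /Fb[i Fi]; rewrite -EFinD.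
by apply: (@le_trans _ _ (F i)%:E); [apply: ereal_inf_lbound; exists i|rewrite lee_fin].
Qed.

Lemma ereal_sup_approx (I : Type) (F : I -> R) (b : R) :
  (forall i, F i <= b) -> (forall e, 0 < e -> exists i, b - e <= F i) ->
  ereal_sup [set (F i)%:E | i in [set: I]] = b%:E.
Proof.
move=> Fb bF; rewrite -[LHS]oppeK -ereal_infN image_comp /=.
rewrite (@ereal_inf_approx _ (fun i => - F i) (- b)) ?EFinN ?oppeK//.
  by move=> i; rewrite lerN2.
by move=> e /bF[i Fi]; exists i; lra.
Qed.

Lemma selection_opp (L U S : T -> R) (mu : R) :
  P.-integrable setT (EFin \o L) -> P.-integrable setT (EFin \o U) ->
  selection P L U mu S ->
  selection P (fun w => - U w) (fun w => - L w) (- mu) (fun w => - S w).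
Proof.
move=> iL iU [mS LSU <-]; split; first exact: measurableT_comp.
  by move=> w; rewrite !lerN2 andbC.
under eq_Rintegral do rewrite -mulN1r.
by rewrite RintegralZl ?mulN1r//; exact: Rintegrable_between iU.
Qed.

End mean_sets.

(** * The substitution s = x^r *)

Section power_moments.
Context d (T : measurableType d) (R : realType) (P : probability T R).
Variables (yL yU : {RV P >-> R}) (r : R).
Hypothesis P_complete : measure_is_complete P.
Hypothesis r0 : 0 < r.
Hypothesis yLU_rpow : {ae P, forall w, yL w <= yU w /\
  forall x, yL w <= x -> rpow x r = spow r x}.

Definition power_lower (w : T) : R := spow r (yL w).

(** The maximum makes the interval nonempty at every point; it changes the
endpoint on a null set only. *)
Definition power_upper (w : T) : R := Num.max (power_lower w) (spow r (yU w)).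

Local Notation L := power_lower.
Local Notation U := power_upper.
Local Notation g := (spow r^-1).

Let rV0 : 0 < r^-1. Proof. by rewrite invr_gt0. Qed.

Let cg : continuous g. Proof. exact: continuous_spow. Qed.

Let measurable_spow (f : T -> R) :
  measurable_fun setT f -> measurable_fun setT (fun w => spow r (f w)).
Proof.
move=> mf; apply: measurableT_comp => //; apply: continuous_measurable_fun.
exact: continuous_spow.
Qed.

Lemma measurable_power_lower : measurable_fun setT L.
Proof. by apply: measurable_spow; exact: measurable_funPT. Qed.

Lemma measurable_power_upper : measurable_fun setT U.
Proof.
apply: measurable_maxr; first exact: measurable_power_lower.
by apply: measurable_spow; exact: measurable_funPT.
Qed.

Lemma power_lower_le_upper w : L w <= U w.
Proof. by rewrite le_max lexx. Qed.

Lemma power_ae : {ae P, forall w, [/\ yL w <= yU w, U w = spow r (yU w) &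
  forall x, yL w <= x -> rpow x r = spow r x]}.
Proof.
apply: filterS yLU_rpow => w [LU rpowE]; split=> //.
by rewrite /U max_r// spow_mono.
Qed.

Lemma power_lowerK w : g (L w) = yL w. Proof. exact: spowK. Qed.

Lemma power_upperK_ae : {ae P, forall w, g (U w) = yU w}.
Proof. by apply: filterS power_ae => w [_ -> _]; exact: spowK. Qed.

Hypothesis iyL : P.-integrable setT (EFin \o yL).
Hypothesis iyU : P.-integrable setT (EFin \o yU).
Hypothesis iyLr : P.-integrable setT (fun w => (rpow (yL w) r)%:E).
Hypothesis iyUr : P.-integrable setT (fun w => (rpow (yU w) r)%:E).

Lemma integrable_power_lower : P.-integrable setT (EFin \o L).
Proof.
apply: (ae_eq_integrable measurable_power_lower iyLr).
by apply: filterS power_ae => w [_ _ ->].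
Qed.

Lemma integrable_power_upper : P.-integrable setT (EFin \o U).
Proof.
apply: (ae_eq_integrable measurable_power_upper iyUr).
by apply: filterS power_ae => w [LU -> ->].
Qed.

Lemma integrable_root_lower : P.-integrable setT (EFin \o (g \o L)).
Proof. by apply: eq_integrable iyL => // w _ /=; rewrite power_lowerK. Qed.

Lemma integrable_root_upper : P.-integrable setT (EFin \o (g \o U)).
Proof.
apply: (ae_eq_integrable (measurable_continuous_comp cg measurable_power_upper) iyU).
exact: power_upperK_ae.
Qed.

(** The selections y of Y with E y^r = mu correspond to the functions S = y^r.
From y to S the clamp repairs the null set where y leaves Y; from S to y the
inverse power gives a selection directly. *)
Lemma restricted_mean_setE mu : restricted_mean_set yL yU r mu =
  [set (\int[P]_w g (S w))%:E | S in selection P L U mu].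
Proof.
have integrable_sel := integrable_selection cg (spow_homo rV0)
  integrable_power_lower integrable_power_upper integrable_root_lower
  integrable_root_upper.
apply/seteqP; split=> [_ [y [ySel _ yr] <-]|_ [S [mS LSU ES] <-]].
  pose S w := clamp (L w) (U w) (spow r (y w)).
  have mS : measurable_fun setT S.
    apply: measurable_clamp; [exact: measurable_power_lower|
      exact: measurable_power_upper|].
    by apply: measurable_spow; exact: measurable_funPT.
  have LSU w : L w <= S w <= U w by apply: clamp_itv; exact: power_lower_le_upper.
  have SE : {ae P, forall w, S w = rpow (y w) r /\ g (S w) = y w}.
    apply: filterS2 power_ae ySel => w [LU UE rpowE].
    rewrite /interval_at/= in_itv/= => /andP[Ly Uy].
    have -> : S w = spow r (y w).
      by apply: clamp_id; rewrite UE !spow_mono ?Ly.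
    by rewrite rpowE// spowK.
  have [iS igS] := integrable_sel _ mS LSU.
  exists S.
    split=> //; rewrite /Rintegral; move: yr; rewrite unlock => yr.
    rewrite -(complete_ae_eq_integral P_complete (h := fun w => (rpow (y w) r)%:E)) ?yr//.
      exact/measurable_EFinP.
    by apply: filterS SE => w [-> _].
  rewrite expectation_def -EFin_Rintegral//; apply: ae_eq_integral => //.
  - by apply/measurable_EFinP; exact: measurable_continuous_comp.
  - by apply/measurable_EFinP; exact: measurable_funPT.
  - by apply: filterS SE => w [_ ->].
have [iS igS] := integrable_sel _ mS LSU.
pose y : {RV P >-> R} := HB.pack (g \o S)
  (isMeasurableFun.Build _ _ _ _ (g \o S) (measurable_continuous_comp cg mS)).
have ySel : {ae P, forall w, yL w <= y w <= yU w /\ rpow (y w) r = S w}.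
  apply: filterS power_ae => w [LU UE rpowE].
  have /andP[Ly Uy] : yL w <= y w <= yU w.
    by rewrite /y/= (le_spowVr (yL w) (S w) r0) (le_spowVl (yU w) (S w) r0) -UE LSU.
  by rewrite rpowE// Ly Uy /y/= spowVK.
exists y; last by rewrite expectation_def -EFin_Rintegral.
split.
- by apply: filterS ySel => w [yLU _]; rewrite /interval_at/= in_itv.
- rewrite unlock; have /integrableP[_] := iS; apply: le_lt_trans.
  rewrite le_eqVlt; apply/orP; left; apply/eqP; apply: eq_integral => w _.
  by rewrite /y /= rpow_normE// spowVK.
- rewrite unlock (complete_ae_eq_integral P_complete (f := EFin \o S)).
  + by rewrite EFin_Rintegral// ES.
  + exact/measurable_EFinP.
  + by apply: filterS ySel => w [_ ->].
Qed.

Lemma integral_Psi lam : (\int[P]_w Psi yL yU r lam w)%E =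
  (\int[P]_w envelope g L U lam w)%:E.
Proof.
rewrite -EFin_Rintegral; last first.
  apply: (@integrable_envelope _ _ _ _ g L U) => //.
  - exact: spow_homo.
  - exact: measurable_power_lower.
  - exact: measurable_power_upper.
  - exact: power_lower_le_upper.
  - exact: integrable_power_lower.
  - exact: integrable_power_upper.
  - exact: integrable_root_upper.
apply: complete_ae_eq_integral => //.
  apply/measurable_EFinP; apply: measurable_envelope => //.
  - exact: measurable_power_lower.
  - exact: measurable_power_upper.
  - exact: power_lower_le_upper.
apply: filterS power_ae => w [LU UE rpowE].
rewrite -ereal_sup_maxon; [|exact: power_lower_le_upper|exact: continuous_lagrangian].
congr ereal_sup; apply/seteqP; split=> y [x] /=; rewrite /interval_at/= in_itv/= => /andP[x1 x2] <-.
  have yLx : yL w <= g x by rewrite (le_spowVr (yL w) x r0).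
  exists (g x); last by rewrite rpowE ?spowVK.
  by rewrite /= in_itv/= yLx (le_spowVl (yU w) x r0) -UE.
exists (spow r x); first by rewrite /= in_itv/= UE !spow_mono// x1.
by rewrite /lagrangian spowK// rpowE.
Qed.

(** A minimum is the opposite of the maximum over the reflected interval, and the
inverse power is odd. *)
Lemma integral_Phi lam : (\int[P]_w Phi yL yU r lam w)%E =
  (- \int[P]_w envelope g (fun w => - U w) (fun w => - L w) lam w)%:E.
Proof.
have mNU : measurable_fun setT (fun w => - U w).
  by apply: measurableT_comp => //; exact: measurable_power_upper.
have mNL : measurable_fun setT (fun w => - L w).
  by apply: measurableT_comp => //; exact: measurable_power_lower.
have NUL w : - U w <= - L w by rewrite lerN2; exact: power_lower_le_upper.
have mE : measurable_fun setT (envelope g (fun w => - U w) (fun w => - L w) lam).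
  exact: measurable_envelope.
have iE : P.-integrable setT
    (EFin \o envelope g (fun w => - U w) (fun w => - L w) lam).
  apply: integrable_envelope => //.
  - exact: spow_homo.
  - exact: integrableN integrable_power_upper.
  - exact: integrableN integrable_power_lower.
  - have := integrableN integrable_root_lower.
    apply: eq_integrable => // w _ /=.
    by rewrite spowN.
have -> : (- \int[P]_w envelope g (fun w => - U w) (fun w => - L w) lam w)%:E =
    (\int[P]_w (- envelope g (fun w => - U w) (fun w => - L w) lam w)%:E)%E.
  by rewrite EFinN -EFin_Rintegral// -integralN// fin_num_adde_defr// integrable_pos_fin_num.
apply: complete_ae_eq_integral => //.
  by apply/measurable_EFinP; exact: measurableT_comp.
apply: filterS power_ae => w [LU UE rpowE].
rewrite EFinN -ereal_sup_maxon; [|exact: NUL|exact: continuous_lagrangian].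
rewrite [RHS]ereal_infEN; congr (- ereal_sup _)%E; apply/seteqP; split.
  move=> y [x] /=; rewrite in_itv/= lerNl lerNr => /andP[x1 x2] <-.
  have yLx : yL w <= g (- x) by rewrite (le_spowVr (yL w) (- x) r0).
  exists (g (- x) + lam * rpow (g (- x)) r)%:E; last first.
    by rewrite rpowE ?spowVK// -EFinN spowN /lagrangian; congr EFin; ring.
  exists (g (- x)) => //=.
  by rewrite /interval_at/= in_itv/= yLx (le_spowVl (yU w) (- x) r0) -UE.
move=> _ [_ [x] /= + <- <-]; rewrite /interval_at/= in_itv/= => /andP[x1 x2].
exists (- spow r x); first by rewrite /= in_itv/= !lerN2 UE !spow_mono// x2.
by rewrite /lagrangian spowN spowK// rpowE//; congr EFin; ring.
Qed.

End power_moments.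

(** * The duality theorem *)

Theorem theorem2p20 (d : measure_display) (T : measurableType d)
    (R : realType) (P : probability T R)
    (hcomplete : measure_is_complete P) (hnonatomic : nonatomic P)
    (yL yU : {RV P >-> R}) (hY : random_interval yL yU)
    (hint : ('E_P[fun w => (`|yL w| + `|yU w|)%R] < +oo)%E)
    (r : R)
    (hr : (exists n : nat, odd n /\ r = n%:R) \/
          (0 < r /\ {ae P, forall w, 0 <= yL w}))
    (hLr : P.-integrable setT (fun w => (rpow (yL w) r)%:E))
    (hUr : P.-integrable setT (fun w => (rpow (yU w) r)%:E))
    (mu : R)
    (hmu : ('E_P[fun w => rpow (yL w) r] <= mu%:E
            <= 'E_P[fun w => rpow (yU w) r])%E) :
  [/\ m_upper yL yU r mu =
        ereal_inf [set (\int[P]_w Psi yL yU r lam w - (lam * mu)%:E)%E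
                  | lam in [set: R]],
      m_lower yL yU r mu =
        ereal_sup [set (\int[P]_w Phi yL yU r lam w - (lam * mu)%:E)%E
                  | lam in [set: R]] &
      exists a b : R,
        [/\ a <= b, m_lower yL yU r mu = a%:E, m_upper yL yU r mu = b%:E,
            restricted_mean_set yL yU r mu = [set x%:E | x in `[a, b]] &
            ('E_P[yL] <= a%:E)%E /\ (b%:E <= 'E_P[yU])%E]].
Proof.
have r0 : 0 < r by case: hr => [[n [on ->]]|[]//]; rewrite ltr0n odd_gt0.
have rV0 : 0 < r^-1 by rewrite invr_gt0.
have yLU_rpow : {ae P, forall w, yL w <= yU w /\
    forall x, yL w <= x -> rpow x r = spow r x}.
  case: hr => [[n [on rE]]|[_ yL0]].
    by apply: filterS (random_interval_ae hY) => w LU; split=> // x _; rewrite rE rpow_odd.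
  apply: filterS2 (random_interval_ae hY) yL0 => w LU L0; split=> // x Lx.
  by rewrite rpow_ge0E// (le_trans L0).
have iyLU : P.-integrable setT (EFin \o (fun w => `|yL w| + `|yU w|)).
  apply/integrableP; split.
    by apply/measurable_EFinP; apply: measurable_funD; apply: measurableT_comp.
  move: hint; rewrite unlock; apply: le_lt_trans; rewrite le_eqVlt; apply/orP; left.
  by apply/eqP; apply: eq_integral => w _; rewrite /= ger0_norm// addr_ge0.
have iyL : P.-integrable setT (EFin \o yL).
  apply: le_integrable iyLU => //; first exact/measurable_EFinP.
  by move=> w _; rewrite /= lee_fin [leRHS]ger0_norm ?addr_ge0// lerDl.
have iyU : P.-integrable setT (EFin \o yU).
  apply: le_integrable iyLU => //; first exact/measurable_EFinP.
  by move=> w _; rewrite /= lee_fin [leRHS]ger0_norm ?addr_ge0// lerDr.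
pose L := power_lower yL r; pose U := power_upper yL yU r; pose g := spow r^-1 : R -> R.
have mL : measurable_fun setT L := measurable_power_lower yL r0.
have mU : measurable_fun setT U := measurable_power_upper yL yU r0.
have LU : forall w, L w <= U w := power_lower_le_upper yL yU r.
have iL : P.-integrable setT (EFin \o L) := integrable_power_lower r0 yLU_rpow hLr.
have iU : P.-integrable setT (EFin \o U) := integrable_power_upper r0 yLU_rpow hUr.
have igL : P.-integrable setT (EFin \o (g \o L)) := integrable_root_lower r0 iyL.
have igU : P.-integrable setT (EFin \o (g \o U)) := integrable_root_upper r0 yLU_rpow iyU.
have cg : continuous g by exact: continuous_spow.
have ng : {homo g : x y / x <= y} by exact: spow_homo.
have gN x : g (- x) = - g x by exact: spowN.
have EL : \int[P]_w L w <= mu.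
  rewrite -lee_fin -EFin_Rintegral//; case/andP: hmu => + _; rewrite unlock.
  apply: le_trans; rewrite le_eqVlt; apply/orP; left; apply/eqP.
  apply/esym; apply: complete_ae_eq_integral => //; first exact/measurable_EFinP.
  by apply: filterS (power_ae r0 yLU_rpow) => w [_ _ ->].
have EU : mu <= \int[P]_w U w.
  rewrite -lee_fin -EFin_Rintegral//; case/andP: hmu => _; rewrite unlock.
  move/le_trans; apply; rewrite le_eqVlt; apply/orP; left; apply/eqP.
  apply: complete_ae_eq_integral => //; first exact/measurable_EFinP.
  by apply: filterS (power_ae r0 yLU_rpow) => w [yLU UE ->//]; rewrite /U UE.
pose NL w := - U w; pose NU w := - L w.
have mNL : measurable_fun setT NL by exact: measurableT_comp.
have mNU : measurable_fun setT NU by exact: measurableT_comp.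
have NLU w : NL w <= NU w by rewrite lerN2.
have iNL : P.-integrable setT (EFin \o NL) by exact: integrableN iU.
have iNU : P.-integrable setT (EFin \o NU) by exact: integrableN iL.
have igNL : P.-integrable setT (EFin \o (g \o NL)).
  by have := integrableN igU; apply: eq_integrable => // w _ /=; rewrite gN.
have igNU : P.-integrable setT (EFin \o (g \o NU)).
  by have := integrableN igL; apply: eq_integrable => // w _ /=; rewrite gN.
have Rintegral_opp (f : T -> R) : P.-integrable setT (EFin \o f) ->
    \int[P]_w (- f w) = - \int[P]_w f w.
  by move=> fi; under eq_Rintegral do rewrite -mulN1r; rewrite RintegralZl ?mulN1r.
have int_sel := integrable_selection cg ng iL iU igL igU.
have weak := weak_duality cg ng mL mU LU iL iU igL igU.
have weakN := weak_duality cg ng mNL mNU NLU iNL iNU igNL igNU.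
have [Sb selb dualb] := strong_duality cg ng mL mU LU iL iU igL igU hnonatomic
  (introT andP (conj EL EU)).
have [|Sa' sela' duala] := strong_duality cg ng mNL mNU NLU iNL iNU igNL igNU hnonatomic
  (mu := - mu).
  by rewrite !Rintegral_opp// !lerN2 EL EU.
pose Sa w := - Sa' w.
have sela : selection P L U mu Sa.
  have := selection_opp iNL iNU sela'; rewrite opprK /NL /NU.
  by under eq_fun do rewrite opprK; under [X in selection _ _ X]eq_fun do rewrite opprK.
have [a Ea] : exists a, \int[P]_w g (Sa w) = a by eexists.
have [b Eb] : exists b, \int[P]_w g (Sb w) = b by eexists.
have gS_opp S : selection P L U mu S ->
    \int[P]_w g (- S w) = - \int[P]_w g (S w).
  move=> [mS LSU _]; rewrite -Rintegral_opp; last by have [] := int_sel _ mS LSU.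
  by apply: eq_Rintegral => w _; rewrite gN.
have Na : \int[P]_w g (Sa' w) = - a.
  by rewrite -Ea -(gS_opp Sa sela); apply: eq_Rintegral => w _; rewrite opprK.
rewrite Eb in dualb; rewrite Na in duala.
have le_b S : selection P L U mu S -> \int[P]_w g (S w) <= b.
  move=> selS; apply/ler_addgt0Pr => e /dualb[l]; apply: le_trans.
  exact: weak.
have ge_a S : selection P L U mu S -> a <= \int[P]_w g (S w).
  move=> selS; rewrite -lerN2 -(gS_opp S selS); apply/ler_addgt0Pr => e /duala[l].
  by apply: le_trans; apply: weakN; exact: selection_opp.
have ab : a <= b by rewrite -Ea; exact: le_b.
have meanE : restricted_mean_set yL yU r mu = [set x%:E | x in `[a, b]].
  rewrite (restricted_mean_setE hcomplete r0 yLU_rpow iyL iyU hLr hUr).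
  apply/seteqP; split=> [_ [S selS <-]|_ [c /= + <-]].
    by exists (\int[P]_w g (S w)) => //=; rewrite in_itv/= ge_a// le_b.
  rewrite in_itv/= -{1}Ea -Eb => cab.
  have [S selS <-] := selection_intermediate_value cg ng iL iU igL igU sela selb cab.
  by exists S.
have upperE : m_upper yL yU r mu = b%:E.
  rewrite /m_upper meanE; apply/le_anti/andP; split.
    by apply/ereal_supP => _ [c /= + <-]; rewrite in_itv/= lee_fin => /andP[].
  by apply: ereal_sup_ubound; exists b => //=; rewrite in_itv/= ab lexx.
have lowerE : m_lower yL yU r mu = a%:E.
  rewrite /m_lower meanE; apply/le_anti/andP; split.
    by apply: ereal_inf_lbound; exists a => //=; rewrite in_itv/= ab lexx.
  by apply/ereal_infP => _ [c /= + <-]; rewrite in_itv/= lee_fin => /andP[].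
split.
- rewrite upperE -(@ereal_inf_approx _ _ (dual_value P g L U mu) b).
  + congr ereal_inf; congr image; apply/funext => l.
    by rewrite (integral_Psi hcomplete r0 yLU_rpow iyU hLr hUr).
  + by move=> l; rewrite -Eb; exact: weak.
  + exact: dualb.
- rewrite lowerE -(@ereal_sup_approx _ _ (fun l => - dual_value P g NL NU (- mu) l) a).
  + congr ereal_sup; congr image; apply/funext => l.
    rewrite (integral_Phi hcomplete r0 yLU_rpow iyL hLr hUr) -EFinB.
    by congr EFin; rewrite /dual_value mulrN; ring.
  + by move=> l; rewrite lerNl -Na; exact: (weakN (- mu) l Sa' sela').
  + by move=> e /duala[l h]; exists l; rewrite lerNr opprB addrC.
- exists a, b; split=> //; split.
    rewrite expectation_def EFin_Rintegral// lee_fin -Ea.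
    have [mSa LSaU _] := sela; have [_ igSa] := int_sel _ mSa LSaU.
    apply: le_Rintegral => // w _; rewrite -(power_lowerK yL r0).
    by apply: ng; have /andP[] := LSaU w.
  have [mSb LSbU _] := selb; have [_ igSb] := int_sel _ mSb LSbU.
  have -> : ('E_P[yU])%E = (\int[P]_w g (U w))%:E.
    rewrite expectation_def -EFin_Rintegral//; apply: complete_ae_eq_integral => //.
      by have /integrableP[] := igU.
    by apply: filterS (power_upperK_ae r0 yLU_rpow) => w /= <-.
  rewrite lee_fin -Eb; apply: le_Rintegral => // w _.
  by apply: ng; have /andP[] := LSbU w.
Qed.
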